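(* If $\vec H$ is an in-arborescence, then every digraph with minimum out-degree at least $|V(\vec H^+)|-1$ contains $\vec H^+$ as a butterfly minor such that the branch set of the apex source is a singleton.
   Context: All digraphs are finite, nonempty and simple: no loops and no two distinct arcs with the same tail and the same head (two arcs with opposite directions between the same pair of vertices are allowed). An in-arborescence is a directed tree with a vertex, called its root, such that every arc is oriented towards the root. For a digraph $\vec H$, $\vec H^+$ is obtained from $\vec H$ by adding a new vertex, called the apex source, and new arcs from the new vertex to all other vertices. A digraph $\vec H$ is a butterfly minor of a digraph $\vec G$ if a digraph isomorphic to $\vec H$ can be obtained from $\vec G$ by a sequence of the following operations: deleting a vertex, deleting an arc, and contracting an arc $(u,v)$ where (in the current digraph) $u$ has out-degree 1 or $v$ has in-degree 1 (and deleting all resulting loops and parallel arcs). In this case, for each $v\in V(\vec H)$, the branch set of $v$ is the set of vertices of $\vec G$ that were contracted into the vertex corresponding to $v$. *)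

(* Defs.v *)
From mathcomp Require Import all_boot.
Set Implicit Arguments.
Unset Strict Implicit.
Unset Printing Implicit Defensive.

Record digraph := Digraph {
  vertex :> finType;
  arc : rel vertex;
  arc_irrefl : irreflexive arc;
  vertex_gt0 : 0 < #|vertex| }.

Definition outdeg (G : digraph) (v : G) : nat := #|[set w | arc v w]|.

(* The default value #|G| of the minimum is never smaller than an out-degree,
   and G is nonempty, so this is the minimum over the vertices. *)
Definition min_outdeg (G : digraph) : nat :=
  \big[minn/#|G|]_(v : G) outdeg v.

Lemma min_outdegP (G : digraph) (d : nat) :
  reflect (forall v : G, d <= outdeg v) (d <= min_outdeg G).
Proof.
have outG (v : G) : outdeg v <= #|G| by exact: max_card.
apply: (iffP idP) => [le_d v | le_d]; last first.
  rewrite /min_outdeg; elim/big_ind: _ => [|m n dm dn|v _]; last exact: le_d.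
    by case/card_gt0P: (vertex_gt0 G) => v _; apply: leq_trans (outG v).
  by rewrite leq_min dm.
apply: leq_trans le_d _; rewrite /min_outdeg.
elim: (index_enum _) (mem_index_enum v) => // w s IHs.
rewrite inE big_cons geq_min => /predU1P[-> | /IHs ->]; last exact: orbT.
by rewrite leqnn.
Qed.

Definition und_arc (G : digraph) : rel G := fun x y => arc x y || arc y x.

(* An orientation of a tree: no two opposite arcs, and the underlying simple
   undirected graph is connected and has no cycle.  The bound on the size is
   there because x, y is an [und_arc]-cycle for every edge xy. *)
Definition directed_tree (G : digraph) : Prop :=
  [/\ forall x y : G, arc x y -> ~~ arc y x,
      forall x y : G, connect (@und_arc G) x y
    & forall c : seq G, ucycle (@und_arc G) c -> size c <= 2].

(* The arc (u, v) is oriented towards r when the path of the underlying tree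
   from u to r goes through v; in particular r has no outgoing arc. *)
Definition oriented_towards (G : digraph) (r : G) : Prop :=
  forall u v : G, arc u v ->
  forall p : seq G, path (@und_arc G) u p -> uniq (u :: p) -> last u p = r ->
  v \in p.

Definition in_arborescence (G : digraph) : Prop :=
  directed_tree G /\ exists r : G, oriented_towards r.

Section Apex.
Variable H : digraph.

Definition apex_arc : rel (option H) := fun x y =>
  match x, y with
  | None, Some _ => true
  | Some x, Some y => arc x y
  | _, None => false
  end.

Lemma apex_arc_irrefl : irreflexive apex_arc.
Proof. by case=> //= x; apply: arc_irrefl. Qed.

Lemma apex_gt0 : 0 < #|{: option H}|.
Proof. by rewrite card_option. Qed.

Definition add_apex : digraph := Digraph apex_arc_irrefl apex_gt0.

Definition apex_source : add_apex := None.

End Apex.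

(* The digraphs obtained from one on V by butterfly operations. Each vertex is
   named by the set of vertices of V contracted into it, so that the
   vertices are pairwise disjoint nonempty sets. *)
Record minor_digraph (V : finType) := MinorDigraph {
  mverts : {set {set V}};
  marcs : {set {set V} * {set V}} }.

Section Operations.
Variable V : finType.
Implicit Types (D : minor_digraph V) (X Y Z : {set V}).

Definition moutdeg D X : nat := #|[set Z | (X, Z) \in marcs D]|.
Definition mindeg D Y : nat := #|[set Z | (Z, Y) \in marcs D]|.

Definition delete_vertex D X : minor_digraph V :=
  MinorDigraph (mverts D :\ X)
    [set a in marcs D | (a.1 != X) && (a.2 != X)].

Definition delete_arc D X Y : minor_digraph V :=
  MinorDigraph (mverts D) (marcs D :\ (X, Y)).

Definition merge X Y Z : {set V} :=
  if (Z == X) || (Z == Y) then X :|: Y else Z.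

(* Parallel arcs are identified because the arcs form a set. *)
Definition contract_arc D X Y : minor_digraph V :=
  MinorDigraph [set merge X Y Z | Z in mverts D]
    [set (merge X Y a.1, merge X Y a.2)
      | a in marcs D & merge X Y a.1 != merge X Y a.2].

End Operations.

Definition initial_minor (G : digraph) : minor_digraph G :=
  MinorDigraph [set [set x] | x in G]
    [set ([set a.1], [set a.2]) | a : G * G & arc a.1 a.2].

Inductive butterfly_reduct (G : digraph) : minor_digraph G -> Prop :=
| Reduct_initial : butterfly_reduct (initial_minor G)
| Reduct_delete_vertex D X :
    butterfly_reduct D -> X \in mverts D ->
    butterfly_reduct (delete_vertex D X)
| Reduct_delete_arc D X Y :
    butterfly_reduct D -> (X, Y) \in marcs D ->
    butterfly_reduct (delete_arc D X Y)
| Reduct_contract_arc D X Y :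
    butterfly_reduct D -> (X, Y) \in marcs D ->
    moutdeg D X = 1 \/ mindeg D Y = 1 ->
    butterfly_reduct (contract_arc D X Y).

Definition minor_iso (H G : digraph) (D : minor_digraph G)
    (phi : H -> {set G}) : Prop :=
  [/\ injective phi, [set phi x | x in H] = mverts D
    & forall x y : H, arc x y = ((phi x, phi y) \in marcs D)].

(* H is a butterfly minor of G, with branch set [branch x] for each x in H. *)
Definition butterfly_minor_with (H G : digraph) (branch : H -> {set G}) : Prop :=
  exists2 D : minor_digraph G, butterfly_reduct D & minor_iso D branch.

Arguments butterfly_minor_with H G branch : clear implicits.

(* Main.v *)
Require Import Defs.
From mathcomp Require Import all_boot.
(* [all_boot] hides [Defs.arc] behind the [arc] of path.v. *)
Import Defs.
Set Implicit Arguments.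
Unset Strict Implicit.
Unset Printing Implicit Defensive.

(* Add the vertices of H one at a time, from the root upwards, keeping a set U
   of unused vertices of G and a model of the part K of H treated so far by
   disjoint in-trees outside U, each containing exactly one vertex of the
   out-boundary of U, so that this boundary has #|K| vertices; moreover no
   nonempty subset of U has a smaller out-boundary.  Let A be a minimal nonempty
   subset of U with #|K| vertices in its out-boundary.  By Menger's theorem,
   disjoint paths from the boundary of A to that of U extend the in-trees, so we
   may take U = A.  By minimality, any u in A can be moved to the model: every
   nonempty subset of A - u has at least #|K| + 1 vertices in its out-boundary.
   We choose u with an arc into the in-tree of the parent of the new vertex of
   H; since out-degrees exceed #|K|, A - u is nonempty.  Once K = H, apply
   Menger's theorem again with A = {v} for any v in U: every in-tree is extended
   to contain an out-neighbour of v, and v is the apex source.  In-trees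
   contract onto their roots by butterfly contractions. *)

(** * Menger's theorem *)

Section Menger.
Variable T : finType.
Implicit Types (e : rel T) (A B R S : {set T}).

Definition succs e R : {set T} := [set z | [exists a in R, e a z]].

Lemma succsP e R z : reflect (exists2 a, a \in R & e a z) (z \in succs e R).
Proof. by rewrite inE; apply: exists_inP. Qed.

(** As every arc leaving [R] ends in [S], a path cannot leave [R] before it meets [S]. *)
Lemma path_stays_in e R S s p :
  succs e R \subset R :|: S -> s \in R :|: S -> path e s p ->
  {in belast s p, forall z, z \notin S} -> {in belast s p, forall z, z \in R}.
Proof.
move=> closR; elim: p s => [|b p IHp] s //= sRS /andP[esb pathp] avoidS.
have sR: s \in R.
  by move: sRS; rewrite inE (negPf (avoidS s (mem_head _ _))) orbF.
move=> z; rewrite inE => /predU1P[-> //|]; apply: IHp => //.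
  by apply: (subsetP closR); apply/succsP; exists s.
by move=> w wp; apply: avoidS; rewrite inE wp orbT.
Qed.

(** A path that visits [R] can leave it only through a later vertex in [S]; here there is none, yet
    the path ends outside [R]. *)
Lemma path_stays_out e R S s p :
  succs e R \subset R :|: S -> last s p \notin R -> path e s p ->
  {in p, forall z, z \notin S} -> {in s :: p, forall z, z \notin R}.
Proof.
move=> closR; elim: p s => [|b p IHp] s /=.
  by move=> sR _ _ z; rewrite inE => /eqP->.
move=> lastR /andP[esb pathp] avoidS.
have outR: {in b :: p, forall z, z \notin R}.
  by apply: IHp => // w wp; apply: avoidS; rewrite inE wp orbT.
move=> z; rewrite inE => /predU1P[->|]; last exact: outR.
apply: contra (outR b (mem_head _ _)) => sR.
have: b \in R :|: S by apply: (subsetP closR); apply/succsP; exists s.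
by rewrite inE (negPf (avoidS b (mem_head _ _))) orbF.
Qed.

Lemma inj_card_onto (I : finType) (s : I -> T) S :
  injective s -> (forall i, s i \in S) -> #|S| <= #|I| ->
  forall w, w \in S -> exists i, s i = w.
Proof.
move=> inj_s sS leSI w wS.
have/eqP eqS: s @: [set: I] == S.
  rewrite eqEcard (card_imset _ inj_s) cardsT leSI andbT.
  by apply/subsetP => _ /imsetP[i _ ->].
by move: wS; rewrite -eqS => /imsetP[i _ ->]; exists i.
Qed.

(** A path may repeat its own vertices. Meeting [A] only at the start and [B] only at the end is
    what lets two families be glued along a separator. *)
Definition disjoint_paths (I : finType) e A B (s : I -> T) (p : I -> seq T) :=
  [/\ forall i, [/\ s i \in A, path e (s i) (p i) & last (s i) (p i) \in B],
      forall i, {in p i, forall z, z \notin A},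
      forall i, {in belast (s i) (p i), forall z, z \notin B}
    & forall i j z, z \in s i :: p i -> z \in s j :: p j -> i = j].

(* [R] plays the part of the vertices that cannot be separated from [A] by the
   set [(A :|: succs e R) :\: R], which separates [A] from [B].
   The induction, due to Goring, removes an arc (x, y): if fewer than #|I|
   vertices S separate A from B without the arc, then S + x and S + y both have
   #|I| elements, and paths from A to S + x extend by paths from S + y to B. *)
Lemma menger (I : finType) e A B :
  (forall R, [disjoint R & B] -> #|I| <= #|(A :|: succs e R) :\: R|) ->
  exists (s : I -> T) (p : I -> seq T), disjoint_paths e A B s p.
Proof.
have [n] := ubnP #|[set a | e a.1 a.2]|.
elim: n e A B => // n IHn e A B; rewrite ltnS => le_e_n sepAB.
have [[x y] exy|no_arc] := pickP [pred a | e a.1 a.2]; last first.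
  have noN R : succs e R = set0.
    apply/setP => z; rewrite in_set0; apply/negP => /succsP[a _ eaz].
    by have := no_arc (a, z); rewrite /= eaz.
  (* Without arcs, taking [A :\: B] for [R] gives the separator [A :&: B], whose vertices serve as
     trivial paths. *)
  have le_I: #|I| <= #|A :&: B|.
    have -> : A :&: B = (A :|: succs e (A :\: B)) :\: (A :\: B).
      by rewrite noN setU0 setDDr setDv set0U.
    by apply: sepAB; rewrite disjoint_subset; apply/subsetP => z;
      rewrite !inE => /andP[].
  pose s i := enum_val (widen_ord le_I (enum_rank i)).
  have sAB i : s i \in A :&: B by apply: enum_valP.
  have inj_s : injective s.
    by move=> i j /enum_val_inj/(congr1 val)/= /ord_inj/enum_rank_inj.
  exists s, (fun=> [::]); split=> //.
    by move=> i; have /setIP[] := sAB i.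
  by move=> i j z; rewrite !inE => /eqP-> /eqP/inj_s.
rewrite /= in exy.
pose e' : rel T := [rel a b | e a b && ((a, b) != (x, y))].
have sub_e : subrel e' e by move=> a b /andP[].
have lt_e' : #|[set a | e' a.1 a.2]| < n.
  apply: leq_trans le_e_n; apply/proper_card/properP; split.
    by apply/subsetP => a; rewrite !inE => /sub_e.
  by exists (x, y); rewrite inE //= /e' /= eqxx andbF.
have succsE R z : z \in succs e R -> z \in succs e' R \/ x \in R /\ z = y.
  case/succsP=> a aR eaz; have [[ax zy]|ne] := (a, z) =P (x, y).
    by right; rewrite -ax.
  by left; apply/succsP; exists a => //; rewrite /e' /= eaz; apply/eqP.
have succsM R R' : R \subset R' -> succs e' R \subset succs e' R'.
  move=> /subsetP sRR'; apply/subsetP => z /succsP[a aR eaz].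
  by apply/succsP; exists a; auto.
have [/forall_inP sep'|] := boolP [forall (R : {set T} | [disjoint R & B]),
    #|I| <= #|(A :|: succs e' R) :\: R|].
  have [s [p [sp pA pB disj]]] := IHn e' A B lt_e' sep'.
  exists s, p; split=> // i; have [sA pathp lastB] := sp i.
  by split=> //; apply: sub_path pathp.
rewrite negb_forall => /existsP[R]; rewrite negb_imply -ltnNge => /andP[RB].
set S := _ :\: R => ltS.
have sAS : A \subset R :|: S.
  by apply/subsetP => z zA; rewrite !inE zA; case: (z \in R).
have closR : succs e' R \subset R :|: S.
  by apply/subsetP => z zR; rewrite !in_setU in_setD in_setU zR orbT andbT orbN.
have RS z : z \in R -> z \notin S by move=> zR; rewrite inE zR.
(* With the arc restored, the separator given by [R] has at least [#|I|] elements, so it is not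
   contained in [S]; only [y] can be new. *)
have [[xR yR] yS]: (x \in R /\ y \notin R) /\ y \notin S.
  have: ~~ ((A :|: succs e R) :\: R \subset S).
    by apply: contraL ltS => /subset_leq_card leS; rewrite -leqNgt;
       apply: leq_trans leS; apply: sepAB.
  case/subsetPn => z /setDP[zA zR] zS.
  have: z \in succs e R.
    by case/setUP: zA zS => // zA; rewrite inE zR inE zA.
  case/succsE => [zR'|[xR zy]]; last by rewrite -zy.
  by move: zS; rewrite inE zR inE zR' orbT.
have xS := RS x xR.
have card1 (w : T) : w \notin S -> #|w |: S| <= #|I|.
  by move=> wS; rewrite cardsU1 wS.
have [] := IHn e' A (x |: S) lt_e'.
  (* The hypothesis is applied to [R1 :&: R]: this set misses [x], so the removed arc adds nothing
     to its separator. *)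
  move=> R1; rewrite disjoint_sym disjoint_subset => /subsetP R1S.
  have xR1 : x \notin R1 by apply: R1S; rewrite !inE eqxx.
  apply: leq_trans (sepAB (R1 :&: R) _) _.
    by apply: disjointWl RB; apply: subsetIr.
  apply/subset_leq_card/subsetP => z /setDP[zA zR].
  have zA' : z \in A :|: succs e' (R1 :&: R).
    case/setUP: zA => [zA|]; first by rewrite inE zA.
    case/succsE => [zR'|[/setIP[]]]; first by rewrite inE zR' orbT.
    by rewrite (negPf xR1).
  rewrite inE; apply/andP; split; last first.
    by apply: subsetP zA'; apply/setUS/succsM/subsetIl.
  apply/negP => zR1.
  have zS : z \in S.
    rewrite inE; move: zR; rewrite inE zR1 /= => ->.
    by apply: subsetP zA'; apply/setUS/succsM/subsetIr.
  by have := R1S z; rewrite !inE /= in zS * => /(_ _)/negP; apply;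
     rewrite ?zS ?orbT.
move=> s [p [sp pA pS disj]].
have [] := IHn e' (y |: S) B lt_e'.
  (* Here the hypothesis is applied to [R :|: R2]; the removed arc can add only [y], which is among
     the sources. *)
  move=> R2 R2B; apply: leq_trans (sepAB (R :|: R2) _) _.
    by rewrite disjoints_subset subUset -!disjoints_subset RB R2B.
  apply/subset_leq_card/subsetP => z /setDP[zA zR].
  move: zR; rewrite in_setU negb_or => /andP[zR zR2].
  rewrite in_setD zR2 /= !in_setU in_set1 in_setD zR /= in_setU.
  case/setUP: zA => [-> //|]; first by rewrite orbT.
  case/succsE => [/succsP[a]|[_ ->]]; last by rewrite eqxx.
  case/setUP => aR eaz.
    have -> : z \in succs e' R by apply/succsP; exists a.
    by rewrite !orbT.
  have -> : z \in succs e' R2 by apply/succsP; exists a.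
  by rewrite !orbT.
move=> s' [p' [sp' pA' pB' disj']].
pose t i := last (s i) (p i).
have t_path i : t i \in s i :: p i by apply: mem_last.
have tS i : t i \in x |: S by case: (sp i).
have inj_s' : injective s'.
  by move=> i j eqs; apply: (disj' i j (s' i)); rewrite ?eqs mem_head.
have inj_t : injective t.
  by move=> i j eqt; apply: (disj i j (t i)); rewrite ?t_path // eqt t_path.
(* By cardinality the second family starts at every vertex of [y |: S]. A path ending at [x]
   continues through the removed arc to [y]; any other continues from its end in [S]. *)
pose link w := if w == x then y else w.
have [i|sg sgE] := @fin_all_exists _ _ (fun i j => s' j = link (t i)).
  apply: (inj_card_onto inj_s' _ (card1 y yS)) => [j|]; first by case: (sp' j).
  have := tS i; rewrite !in_setU1 /link.
  by case: (t i == x) => [_|/= ->]; rewrite ?eqxx ?orbT.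
pose r i := if t i == x then s' (sg i) :: p' (sg i) else p' (sg i).
have rQ i : {subset r i <= s' (sg i) :: p' (sg i)}.
  by rewrite /r => z; case: ifP => // _ zr; rewrite inE zr orbT.
(* The first family lies in [R] before its last vertices and the second lies outside [R], so the two
   can meet only in [S]. *)
have P_R i : {in belast (s i) (p i), forall z, z \in R}.
  have [sA pathp _] := sp i; apply: (path_stays_in closR) => //.
    exact: (subsetP sAS).
  by move=> z /pS; rewrite !inE negb_or => /andP[].
have Q_R j : {in s' j :: p' j, forall z, z \notin R}.
  have [sA pathp lastB] := sp' j; apply: (path_stays_out closR) => //.
    by apply: contraL RB => lR; apply/pred0Pn; exists (last (s' j) (p' j));
       rewrite /= lR.
  by move=> z /pA'; rewrite !inE negb_or => /andP[].
have Q_S j z : z \in s' j :: p' j -> z \in S -> z = s' j.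
  rewrite inE => /predU1P[//|/pA' + zS].
  by rewrite in_setU1 zS orbT.
have notB z : z \in R -> z \notin B by move=> zR; rewrite (disjointFr RB zR).
have last_r i : last (t i) (r i) = last (s' (sg i)) (p' (sg i)).
  by rewrite /r sgE /link; case: eqP.
exists s, (fun i => p i ++ r i); split=> /=.
- move=> i; have [sA pathp _] := sp i; have [_ pathp' lastB] := sp' (sg i).
  split=> //; last by rewrite last_cat last_r.
  rewrite cat_path (sub_path sub_e pathp) /= -/(t i) /r.
  have := sub_path sub_e pathp'; rewrite sgE /link.
  by have [->|_ //] := (t i =P x); rewrite /= exy.
- move=> i z; rewrite mem_cat => /orP[|zr]; first exact: pA.
  have zR := Q_R _ _ (rQ i z zr).
  apply/negP => /(subsetP sAS); rewrite inE (negPf zR) /= => zS.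
  move: zr; rewrite /r; case: eqP => [tx|_ /pA']; last by rewrite in_setU1 zS orbT.
  by move=> /Q_S/(_ zS); rewrite sgE /link tx eqxx => zy; rewrite -zy zS in yS.
- move=> i z; rewrite belast_cat mem_cat -/(t i) => /orP[/P_R/notB //|].
  rewrite /r; case: eqP => [->|tx] /=.
    by rewrite inE => /predU1P[->|/pB' //]; apply: notB.
  have -> : t i = s' (sg i) by rewrite sgE /link; case: (t i =P x) tx.
  exact: pB'.
have PQ i1 i2 z : z \in s i1 :: p i1 -> z \in r i2 -> i1 = i2.
  move=> zP zr; have zQ := rQ _ _ zr; have zR := Q_R _ _ zQ.
  have zt : z = t i1.
    move: zP; rewrite lastI mem_rcons inE => /predU1P[//|/P_R].
    by rewrite (negPf zR).
  have zS : z \in S.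
    by have := tS i1; rewrite -zt in_setU1 => /predU1P[zx|//]; rewrite zx xR in zR.
  have := Q_S _ _ zQ zS; rewrite sgE /link; case: eqP => [_ zy|_ zt2].
    by rewrite -zy zS in yS.
  by apply: inj_t; rewrite -zt.
move=> i1 i2 z; rewrite -!cat_cons !mem_cat => /orP[z1|z1] /orP[z2|z2].
- exact: disj z1 z2.
- exact: PQ z1 z2.
- by rewrite (PQ _ _ _ z2 z1).
have /(congr1 s') := disj' _ _ _ (rQ _ _ z1) (rQ _ _ z2).
have tS' i : t i != x -> t i \in S.
  by have := tS i; rewrite in_setU1 => /predU1P[->|//]; rewrite eqxx.
rewrite !sgE /link => eq12; apply: inj_t; move: eq12.
have [-> |/tS' t1] := eqVneq (t i1) x; have [-> |/tS' t2] := eqVneq (t i2) x => //.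
  by move=> yt; rewrite yt t2 in yS.
by move=> ty; rewrite -ty t1 in yS.
Qed.

End Menger.

(** * Butterfly contraction of in-trees *)

Section Reductions.
Variable G : digraph.
Implicit Types (D : minor_digraph G) (F : {set G * G}).

Lemma butterfly_delete_arcs D (E : {set {set G} * {set G}}) :
  butterfly_reduct D -> E \subset marcs D ->
  butterfly_reduct (MinorDigraph (mverts D) E).
Proof.
have [n] := ubnP #|marcs D :\: E|; elim: n D => // n IHn D; rewrite ltnS.
move=> le_n redD sED; have [DE|[[X Y] XY]] := set_0Vmem (marcs D :\: E).
  have <- : marcs D = E by apply/eqP; rewrite eqEsubset sED andbT -setD_eq0 DE.
  by case: D redD {le_n sED DE}.
have [XYD XYE] := setDP XY.
apply: (IHn (delete_arc D X Y)).
- apply: leq_trans le_n; rewrite [X in _ < X](cardsD1 (X, Y)) XY /= ltnS.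
  by rewrite setDDl setUC -setDDl.
- exact: Reduct_delete_arc.
- by rewrite subsetD1 sED.
Qed.

Lemma butterfly_delete_vertices D (M : {set {set G}}) :
  butterfly_reduct D -> M \subset mverts D ->
  exists2 D', butterfly_reduct D' & mverts D' = M /\
    {in M &, forall X Y, (X, Y) \in marcs D -> (X, Y) \in marcs D'}.
Proof.
have [n] := ubnP #|mverts D :\: M|; elim: n D => // n IHn D; rewrite ltnS.
move=> le_n redD sMD; have [DM|[X XDM]] := set_0Vmem (mverts D :\: M).
  exists D => //; split=> //.
  by apply/eqP; rewrite eqEsubset sMD andbT -setD_eq0 DM.
have [XD XM] := setDP XDM.
have [||| D' redD' [eqM arcM]] := IHn (delete_vertex D X).
- apply: leq_trans le_n; rewrite [X in _ < X](cardsD1 X) XDM /= ltnS.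
  by rewrite setDDl setUC -setDDl.
- exact: Reduct_delete_vertex.
- by rewrite subsetD1 sMD.
exists D' => //; split=> // Y Z YM ZM YZ; apply: arcM => //.
by rewrite inE YZ /=; apply/andP; split; apply: contraNneq XM => <-.
Qed.

(** Contractions are tracked in [G] itself: [q] sends a vertex to the contracted set containing it,
    and [F] holds the arcs of [G] that are retained. *)
Definition quotient_minor (q : G -> {set G}) F : minor_digraph G :=
  MinorDigraph [set q a | a in G]
    [set (q a.1, q a.2) | a in F & q a.1 != q a.2].

Lemma initial_minorE :
  initial_minor G = quotient_minor set1 [set a : G * G | arc a.1 a.2].
Proof.
congr MinorDigraph; apply/setP => -[X Y].
apply/imsetP/imsetP => -[a].
  rewrite inE => arca ->; exists a => //; rewrite !inE arca /=.
  by apply/eqP => /set1_inj eqa; rewrite eqa arc_irrefl in arca.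
by rewrite !inE => /andP[arca _] ->; exists a; rewrite ?inE.
Qed.

Lemma contract_quotient_minor q F X Y :
  contract_arc (quotient_minor q F) X Y
    = quotient_minor (fun a => merge X Y (q a)) F.
Proof.
congr MinorDigraph.
  by rewrite /= -imset_comp.
apply/setP => A; apply/imsetP/imsetP => -[a].
  rewrite inE => /andP[/imsetP[b]]; rewrite inE => /andP[bF _] -> /= neb ->.
  by exists b; rewrite // inE bF.
rewrite inE => /andP[aF nea] ->; exists (q a.1, q a.2) => //.
rewrite inE nea andbT; apply/imsetP; exists a => //; rewrite inE aF /=.
by apply: contraNneq nea => ->.
Qed.

Lemma quotient_minor_eq q q' F : q =1 q' -> quotient_minor q F = quotient_minor q' F.
Proof.
move=> eqq; congr MinorDigraph; first exact: eq_imset.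
apply/setP => A; apply/imsetP/imsetP => -[a]; rewrite inE => aF ->;
  by exists a; rewrite ?inE ?eqq // -!eqq.
Qed.

Lemma butterfly_quotient_subset q F F' :
  F' \subset F -> butterfly_reduct (quotient_minor q F) ->
  butterfly_reduct (quotient_minor q F').
Proof.
move=> /subsetP sF red; apply: (butterfly_delete_arcs red).
by apply/imsetS/subsetP => a; rewrite !inE => /andP[/sF->].
Qed.

Section Labels.
Variable I : eqType.
Implicit Types l : G -> option I.

(** Labels group vertices into growing branch sets; unlabelled vertices are not contracted yet. *)
Definition label_class l (a : G) : {set G} :=
  if l a is Some x then [set b | l b == Some x] else [set a].

Definition set_label l y x : G -> option I :=
  fun a => if a == y then Some x else l a.

Lemma mem_label_class l a : a \in label_class l a.
Proof. by rewrite /label_class; case E: (l a) => [x|]; rewrite inE ?E. Qed.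

Lemma label_class_unlabelled l y a :
  l y = None -> (label_class l a == [set y]) = (a == y).
Proof.
move=> ly; apply/eqP/eqP => [eqy|->]; last by rewrite /label_class ly.
by have := mem_label_class l a; rewrite eqy inE => /eqP.
Qed.

(** An unlabelled [y] is alone in its class, so contracting it into the class of [z] amounts to
    copying the label of [z]. *)
Lemma merge_label_class l y z x a : l y = None -> l z = Some x ->
  merge [set y] (label_class l z) (label_class l a)
    = label_class (set_label l y x) a.
Proof.
move=> ly lz; rewrite /merge label_class_unlabelled //.
have classx : [set y] :|: label_class l z = [set b | set_label l y x b == Some x].
  apply/setP => b; rewrite /label_class lz !inE /set_label.
  by case: (b == y); rewrite ?eqxx.
rewrite classx; have [->|nay] := eqVneq a y; first by rewrite /label_class /set_label eqxx.
have la' : set_label l y x a = l a by rewrite /set_label (negPf nay).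
rewrite /= /label_class lz la'.
case la: (l a) => [x'|]; last first.
  case: eqP => // /setP/(_ a); by rewrite !inE la eqxx.
have [-> |nex] := eqVneq x' x; first by rewrite eqxx.
case: eqP => [/setP/(_ a)|_].
  by rewrite !inE la eqxx => /esym/eqP[eqx]; rewrite eqx eqxx in nex.
apply/setP => b; rewrite !inE /set_label; have [->|//] := eqVneq b y.
by rewrite ly; apply/esym/eqP => -[eqx]; rewrite eqx eqxx in nex.
Qed.

(* Absorbs [y] into the class of [z]: all the other arcs leaving [y] are deleted
   first, so that [y] has out-degree 1. *)
Lemma butterfly_absorb l F y z x :
  butterfly_reduct (quotient_minor (label_class l) F) ->
  l y = None -> l z = Some x -> (y, z) \in F ->
  butterfly_reduct (quotient_minor (label_class (set_label l y x))
    [set a in F | (a.1 == y) ==> (a.2 == z)]).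
Proof.
move=> red ly lz yzF; set F' := [set a in F | _].
have red' : butterfly_reduct (quotient_minor (label_class l) F').
  by apply: butterfly_quotient_subset red; apply/subsetP => a; rewrite inE => /andP[].
have nezy : label_class l z != [set y].
  by rewrite label_class_unlabelled //; apply/eqP => eqzy; rewrite eqzy ly in lz.
have yE : label_class l y = [set y] by rewrite /label_class ly.
rewrite -(quotient_minor_eq _ (fun a => merge_label_class a ly lz)).
rewrite -contract_quotient_minor; apply: Reduct_contract_arc => //.
  apply/imsetP; exists (y, z); last by rewrite /= yE.
  by rewrite !inE yzF /= !eqxx yE eq_sym.
left; apply/eqP/cards1P; exists (label_class l z); apply/setP => Z.
rewrite !inE; apply/imsetP/eqP => [[a]|->].
  rewrite !inE => /andP[/andP[_ az] _] [eqy ->].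
  move/eqP: eqy; rewrite eq_sym label_class_unlabelled // => ay.
  by rewrite ay in az; rewrite (eqP az).
exists (y, z); last by rewrite /= yE.
by rewrite !inE yzF /= !eqxx yE eq_sym.
Qed.

End Labels.
End Reductions.

(** Testing only the heads of arcs against [B] suffices, since the walks start in [B]. *)
Definition rooted (T : finType) (e : rel T) (B : {set T}) (r : T) : Prop :=
  r \in B /\ {in B, forall z, connect [rel a b | e a b && (b \in B)] z r}.

(** * From disjoint rooted sets to a butterfly minor with an apex *)

Section Certificate.
Variables (G H : digraph) (B : H -> {set G}) (r : H -> G).
Hypothesis disjB : forall x y z, z \in B x -> z \in B y -> x = y.
Hypothesis rootB : forall x, rooted (@arc G) (B x) (r x).

(* [F] may lack arcs leaving an absorbed vertex: only the arcs leaving the roots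
   and the vertices still to be absorbed are needed. *)
Definition good_state (l : G -> option H) (F : {set G * G}) :=
  [/\ butterfly_reduct (quotient_minor (label_class l) F),
      forall x, l (r x) = Some x,
      forall a x, l a = Some x -> a \in B x
    & forall a b, arc a b -> l a = None \/ (exists x, a = r x) -> (a, b) \in F].

(** Labelling only the roots leaves every class a singleton, as the roots of disjoint sets
    differ. *)
Lemma good_state_initial : exists l F, good_state l F.
Proof.
pose l a := [pick x | a == r x].
have lr x : l (r x) = Some x.
  rewrite /l; case: pickP => [y /eqP eqr|/(_ x)]; last by rewrite eqxx.
  have [[ry _] [rx _]] := (rootB y, rootB x).
  by rewrite -eqr in ry; rewrite (disjB ry rx).
exists l, [set a : G * G | arc a.1 a.2]; split=> // [|a x|a b ab _]; last by rewrite inE.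
  suff <- : initial_minor G = quotient_minor (label_class l) [set a : G * G | arc a.1 a.2].
    exact: Reduct_initial.
  rewrite initial_minorE; apply: quotient_minor_eq => a.
  rewrite /label_class; case la: (l a) => [x|//].
  apply/setP => b; rewrite !inE; move: la; rewrite /l; case: pickP => // y /eqP-> [<-].
  apply/eqP/eqP => [->|]; first exact: lr.
  by case: pickP => // z /eqP-> [->].
by rewrite /l; case: pickP => // y /eqP-> [<-]; case: (rootB y).
Qed.

(** A walk inside [B x] from an unlabelled vertex to the labelled root uses an arc from an
    unlabelled [y] to a labelled [z]. Absorbing [y] lowers the number of unlabelled vertices. *)
Lemma good_state_final :
  exists l F, good_state l F /\ forall x a, a \in B x -> l a = Some x.
Proof.
have [l [F]] := good_state_initial.
have [n] := ubnP #|[set a | l a == None]|; elim: n l F => // n IHn l F.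
rewrite ltnS => le_n good; have [red lr lB arcF] := good.
have [x Bx|lab] := pickP [pred x | [exists a in B x, l a == None]]; last first.
  exists l, F; split=> // x a aB; case la: (l a) => [y|].
    by rewrite (disjB (lB _ _ la) aB).
  by have /exists_inP[] := lab x; exists a; rewrite ?la.
have [y [z [yB ly lz yz]]] : exists y z,
    [/\ y \in B x, l y = None, l z = Some x & arc y z].
  have [a aB /eqP la] := exists_inP Bx.
  have [_ /(_ a aB)/connectP[p]] := rootB x.
  elim: p a aB la => [|b p IHp] a aB la /=; first by move=> _ ra; rewrite -ra lr in la.
  move=> /andP[/andP[ab bB] pathp] lastp.
  case lb: (l b) => [x'|]; last exact: IHp lastp.
  by exists a, b; split; rewrite // lb (disjB bB (lB _ _ lb)).
have yzF : (y, z) \in F by apply: arcF; [|left].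
apply: (IHn (set_label l y x) [set a in F | (a.1 == y) ==> (a.2 == z)]).
  apply: leq_trans le_n; apply/proper_card/properP; split.
    by apply/subsetP => a; rewrite !inE /set_label; case: (a == y).
  by exists y; rewrite !inE ?ly // /set_label eqxx.
have ry x' : r x' != y by apply: contra_eqN ly => /eqP<-; rewrite lr.
split=> [|x'|a x'|a b ab]; first exact: butterfly_absorb.
- by rewrite /set_label (negPf (ry x')).
- by rewrite /set_label; case: eqP => [-> [<-]|_ /lB].
(* The deleted arcs leave [y], which is now labelled and is not a root, so the last clause no longer
   asks for them. *)
rewrite inE /set_label /=; have [->|_] := eqVneq a y.
  by case=> [//|[x' eqy]]; have := ry x'; rewrite eqy eqxx.
by rewrite andbT; apply: arcF.
Qed.

(** Once all labels are assigned, the labelled classes are the sets [B x]. The roots, and [v], which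
    stays unlabelled, have kept all their out-arcs, so every required arc is present and the rest is
    deleted. *)
Lemma apex_butterfly_minor (v : G) :
  (forall x, v \notin B x) ->
  (forall x, exists2 z, z \in B x & arc v z) ->
  (forall x y, arc x y -> exists2 z, z \in B y & arc (r x) z) ->
  butterfly_minor_with (add_apex H) G (fun x => if x is Some y then B y else [set v]).
Proof.
move=> vB varc rarc; set phi := fun x : add_apex H => _.
have [l [F [[red lr lB arcF] Bl]]] := good_state_final.
have lv : l v = None.
  by case lv: (l v) => [x|//]; have := vB x; rewrite (lB _ _ lv).
have phiE a x : a \in B x -> label_class l a = phi (Some x).
  move=> aB; rewrite /label_class (Bl _ _ aB); apply/setP => b; rewrite inE.
  by apply/eqP/idP => [/lB|/Bl].
have phiv : label_class l v = phi None by rewrite /label_class lv.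
have phi_inj : injective phi.
  move=> [x|] [y|] //=.
  - have [rB _] := rootB x => eqB; congr Some; apply: (@disjB _ _ (r x)) => //.
    by rewrite -eqB.
  - by move=> eqB; have := vB x; rewrite eqB set11.
  - by move=> eqB; have := vB y; rewrite -eqB set11.
have [|D redD [vertsD arcsD]] :=
    butterfly_delete_vertices (M := [set phi x | x in add_apex H]) red.
  apply/subsetP => _ /imsetP[[x|] _ ->].
    have [rB _] := rootB x.
    by apply/imsetP; exists (r x) => //; rewrite (phiE (r x) x).
  by apply/imsetP; exists v; rewrite // phiv.
exists (MinorDigraph (mverts D)
    [set (phi a.1, phi a.2) | a : add_apex H * add_apex H & arc a.1 a.2]).
  apply: butterfly_delete_arcs redD _.
  apply/subsetP => _ /imsetP[[x y] + ->]; rewrite inE /= => xy.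
  apply: arcsD; [exact: imset_f | exact: imset_f |].
  have nexy : phi x != phi y.
    apply/eqP => /phi_inj eqxy; have := @arc_irrefl (add_apex H) x.
    by rewrite {2}eqxy /= xy.
  case: x y xy nexy => [x|] [y|] //= xy nexy.
    have [z zB xz] := rarc x y xy; have [rB _] := rootB x.
    apply/imsetP; exists (r x, z); rewrite /= ?(phiE _ _ rB) ?(phiE _ _ zB) //.
    rewrite inE /= (phiE _ _ rB) (phiE _ _ zB) nexy andbT.
    by apply: arcF => //; right; exists x.
  have [z zB vz] := varc y.
  apply/imsetP; exists (v, z); rewrite /= ?phiv ?(phiE _ _ zB) //.
  rewrite inE /= phiv (phiE _ _ zB) nexy andbT.
  by apply: arcF => //; left.
split=> // x y; apply/idP/imsetP => [xy|[[x' y']]].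
  by exists (x, y); rewrite ?inE.
by rewrite inE /= => xy [/phi_inj-> /phi_inj->].
Qed.

End Certificate.

(** * Construction of the model *)

Section Arborescence.
Variable H : digraph.
Hypothesis treeH : directed_tree H.
Variable r : H.
Hypothesis toR : oriented_towards r.

(** If [y] came later on the path, the arc would close a cycle on at least three vertices. *)
Lemma simple_path_head (x y : H) p :
  arc x y -> path (@und_arc H) x p -> uniq (x :: p) -> last x p = r ->
  exists p', p = y :: p'.
Proof.
move=> xy pathp uniqp lastp; have yp := toR xy pathp uniqp lastp.
have [_ _ acyc] := treeH.
case/splitPr: yp pathp uniqp {lastp} => -[|z p1] p2; first by exists p2.
rewrite -cat_rcons cat_path -cat_cons cat_uniq.
move=> /andP[pathp _] /andP[uniqp _].
have /acyc : ucycle (@und_arc H) (x :: rcons (z :: p1) y).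
  by rewrite /ucycle uniqp andbT /cycle rcons_path pathp last_rcons /und_arc xy orbT.
by rewrite /= size_rcons.
Qed.

Lemma simple_path_to_root (x : H) :
  exists p, [/\ path (@und_arc H) x p, uniq (x :: p) & last x p = r].
Proof.
have [_ conn _] := treeH; have /connectP[p pathp ->] := conn x r.
by case/shortenP: pathp => p' pathp' uniqp' _; exists p'.
Qed.

Lemma out_arc_unique (x y z : H) : arc x y -> arc x z -> y = z.
Proof.
have [p [pathp uniqp lastp]] := simple_path_to_root x.
move=> xy xz; have [p1 eqp] := simple_path_head xy pathp uniqp lastp.
by have [p2] := simple_path_head xz pathp uniqp lastp; rewrite eqp => -[].
Qed.

(** An out-neighbour in [D] is the next vertex on the simple path to [r], so moving to it shortens
    the path. With [D] the set of untreated vertices, this selects the next vertex of [H]. *)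
Lemma exists_sink_in (D : {set H}) :
  D != set0 -> exists2 x, x \in D & forall y, arc x y -> y \notin D.
Proof.
case/set0Pn => x xD; have [p [pathp uniqp lastp]] := simple_path_to_root x.
elim: p x xD pathp uniqp lastp => [|z p IHp] x xD pathp uniqp lastp.
  exists x => // y xy.
  by have [p'] := simple_path_head xy pathp uniqp lastp.
have [y /andP[xy yD]|outD] := pickP [pred y | arc x y && (y \in D)]; last first.
  by exists x => // y xy; have := outD y; rewrite /= xy /= => ->.
have [p' [eqz _]] := simple_path_head xy pathp uniqp lastp.
move: pathp uniqp lastp; rewrite eqz /= => /andP[_ pathp] /andP[_ uniqp] lastp.
exact: IHp yD pathp uniqp lastp.
Qed.

End Arborescence.

Lemma path_connect_in (T : finType) (e : rel T) (B : {set T}) s p :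
  path e s p -> {subset p <= B} ->
  {in s :: p, forall z,
     connect [rel a b | e a b && (b \in B)] z (last s p)}.
Proof.
elim: p s => [|b p IHp] s /=; first by move=> _ _ z; rewrite inE => /eqP->.
move=> /andP[sb pathp] pB; have bB := pB b (mem_head _ _).
have conn : {in b :: p, forall z,
    connect [rel a b | e a b && (b \in B)] z (last b p)}.
  by apply: IHp => // z zp; apply: pB; rewrite inE zp orbT.
move=> z; rewrite inE => /predU1P[->|]; last exact: conn.
by apply: connect_trans (conn b (mem_head _ _)); apply: connect1; rewrite /= sb.
Qed.

Lemma rooted_add_path (T : finType) (e : rel T) (B : {set T}) r s p :
  rooted e B r -> path e s p -> last s p \in B ->
  rooted e (B :|: [set z in s :: p]) r.
Proof.
move=> [rB conn] pathp lastB; split; first by rewrite inE rB.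
have connB z : z \in B ->
    connect [rel a b | e a b && (b \in B :|: [set z in s :: p])] z r.
  move/conn; apply: connect_sub => a b /= /andP[eab bB].
  by apply: connect1; rewrite /= eab inE bB.
move=> z; rewrite in_setU in_set => /orP[/connB //|zp].
apply: connect_trans (connB _ lastB); apply: path_connect_in zp => //.
by move=> w wp; rewrite in_setU in_set inE wp !orbT.
Qed.

(** * Linking the in-trees and adding a vertex to the model *)

Section Construction.
Variables H G : digraph.
Implicit Types (K : {set H}) (A U : {set G}).

Definition boundary A : {set G} := succs (@arc G) A :\: A.

Lemma boundaryP A z :
  reflect (z \notin A /\ exists2 a, a \in A & arc a z) (z \in boundary A).
Proof. by rewrite inE; apply: (iffP andP) => -[zA /succsP]. Qed.

(* By the third clause [B x] is spanned by an in-tree with root [r x]; its arcs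
   and the arcs leaving [r x] are the only ones the contractions need. *)
Definition partial_model K U (B : H -> {set G}) (r t : H -> G) :=
  [/\ {in K, forall x, [disjoint B x & U]},
      {in K &, forall x y z, z \in B x -> z \in B y -> x = y},
      {in K, forall x, rooted (@arc G) (B x) (r x)},
      {in K, forall x, t x \in B x /\ t x \in boundary U}
    & {in K &, forall x y, arc x y -> exists2 z, z \in B y & arc (r x) z}].

Definition well_linked k U :=
  forall A, A \subset U -> A != set0 -> k <= #|boundary A|.

(** Menger's paths run from [boundary A] to [boundary U] and end one at each [t x]. Prefixed to the
    in-trees, they preserve the roots and move the contact vertices to [boundary A]. *)
Lemma relink K U B r t A :
  partial_model K U B r t -> boundary U \subset t @: K ->
  well_linked #|K| U -> A \subset U -> A != set0 ->
  exists B' t', partial_model K A B' r t'.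
Proof.
move=> [disjU disjB rootB tB arcB] bdU linked sAU A0.
have leU : #|boundary U| <= #|K|.
  exact: leq_trans (subset_leq_card bdU) (leq_imset_card _ _).
(* Arcs start in [U], so only the last vertex of a path may lie outside [U]; they do not end in [A],
   so a path starting outside [A] avoids it. *)
pose e : rel G := [rel a b | [&& arc a b, a \in U & b \notin A]].
have [|s [p [sp _ pU disj]]] := @menger G {x | x \in K} e (boundary A) (boundary U).
  move=> R RU; rewrite card_sig.
  (* The out-boundary of [A :|: (R :&: U)] lies in the separator given by [R]. *)
  apply: leq_trans (linked (A :|: (R :&: U)) _ _) _.
  - by rewrite subUset sAU subsetIr.
  - by apply: contraNneq A0 => A0; rewrite -subset0 -A0 subsetUl.
  apply/subset_leq_card/subsetP => z /boundaryP[].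
  rewrite in_setU in_setI negb_or negb_and => /andP[zA zR] [a aA az].
  have zU : z \in U \/ z \in boundary U.
    have [|zU] := boolP (z \in U); [by left | right].
    apply/boundaryP; split=> //; exists a => //.
    by move: aA; rewrite inE => /orP[/(subsetP sAU)|/setIP[]].
  have zR' : z \notin R.
    by case: zU zR => [-> | zU _]; rewrite ?orbF // (disjointFl RU zU).
  rewrite in_setD zR' in_setU; move: aA; rewrite in_setU => /orP[aA|/setIP[aR aU]].
    by apply/orP; left; apply/boundaryP; split=> //; exists a.
  by apply/orP; right; apply/succsP; exists a => //=; rewrite /e /= az aU.
have path_e i : path e (s i) (p i) by case: (sp i).
have sub_arc : subrel e (@arc G) by move=> a b /andP[].
have belastU i : {subset belast (s i) (p i) <= U}.
  elim: (p i) (s i) (path_e i) => //= b q IHq a /andP[/and3P[_ aU _] pathq] z.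
  by rewrite inE => /predU1P[->|/(IHq _ pathq)].
have pathA i z : z \in s i :: p i -> z \notin A.
  rewrite inE => /predU1P[->|]; first by have [/boundaryP[]] := sp i.
  elim: (p i) (s i) (path_e i) => //= b q IHq a /andP[/and3P[_ _ bA] pathq].
  by rewrite inE => /predU1P[->|/(IHq _ pathq)].
have inj_last : injective (fun i => last (s i) (p i)).
  by move=> i j eqt; apply: (disj i j (last (s i) (p i))); rewrite ?mem_last // eqt mem_last.
have [g _] := set0Pn _ A0.
(* Paths are reindexed by the vertex [t x] at which they end; the value outside [K] is arbitrary. *)
have [x|q qP] := @fin_all_exists _ _ (fun x (q : G * seq G) => x \in K ->
    exists i, q = (s i, p i) /\ last (s i) (p i) = t x).
  have [xK|] := boolP (x \in K); last by exists (g, [::]).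
  have [|||i lasti] := inj_card_onto inj_last (S := boundary U) _ _ (w := t x).
  - by move=> i; have [] := sp i.
  - by rewrite card_sig.
  - by have [] := tB x xK.
  by exists (s i, p i) => _; exists i.
pose Q x : {set G} := [set z in (q x).1 :: (q x).2].
have QU x z : x \in K -> z \in Q x -> z \in U \/ z = t x.
  move=> xK; have [i [eqq lasti]] := qP x xK; rewrite inE eqq /= lastI mem_rcons.
  by rewrite inE lasti => /predU1P[|/belastU]; [right | left].
(* A new path lies in [U], except perhaps at its end [t y], which already belongs to [B y]. *)
have BQ x y z : x \in K -> y \in K -> z \in B x -> z \in Q y -> x = y.
  move=> xK yK zB /(QU _ _ yK)[zU|zt].
    by have := disjointFr (disjU x xK) zB; rewrite zU.
  by apply: disjB zB _ => //; rewrite zt; have [] := tB y yK.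
exists (fun x => B x :|: Q x), (fun x => (q x).1); split.
- move=> x xK; rewrite disjoint_sym disjoint_subset; apply/subsetP => z zA.
  rewrite !inE negb_or (disjointFl (disjU x xK) (subsetP sAU z zA)) /=.
  have [i [-> _]] := qP x xK; rewrite -in_cons; apply: contraL zA; exact: pathA.
- move=> x y xK yK z; rewrite !in_setU => /orP[zx|zx] /orP[zy|zy].
  + exact: disjB zx zy.
  + exact: BQ zx zy.
  + by rewrite (BQ y x z).
  have [[i [eqx lasti]] [j [eqy lastj]]] := (qP x xK, qP y yK).
  move: zx zy; rewrite !in_set eqx eqy => zi zj.
  have eqij := disj i j z zi zj; have [[tx _] [ty _]] := (tB x xK, tB y yK).
  by apply: (disjB x y xK yK (t x)) => //; rewrite -lasti eqij lastj.
- move=> x xK; have [i [eqx lasti]] := qP x xK; have [tx _] := tB x xK.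
  rewrite /Q eqx /=; apply: rooted_add_path; [exact: rootB | | by rewrite lasti].
  exact: (sub_path sub_arc (path_e i)).
- move=> x xK; rewrite in_setU in_set mem_head orbT; split=> //.
  by have [i [-> _]] := qP x xK; have [] := sp i.
move=> x y xK yK /(arcB x y xK yK)[z zB rz]; exists z => //.
by rewrite in_setU zB.
Qed.

Definition stage K U :=
  [/\ U != set0, well_linked #|K| U
    & exists B r t, partial_model K U B r t /\ boundary U \subset t @: K].

Lemma stage_step K U x :
  (forall v : G, #|K| < outdeg v) ->
  {in K, forall y z, arc y z -> z \in K} ->
  (forall y z, arc x y -> arc x z -> y = z) ->
  (forall y, arc x y -> y \in K) -> x \notin K ->
  stage K U -> exists U', stage (x |: K) U'.
Proof.
move=> outG closK uniqx xK' xK [U0 linked [B [r [t [model bdU]]]]].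
pose tight A := [&& A \subset U, A != set0 & #|boundary A| <= #|K|].
have tightU : tight U.
  rewrite /tight subxx U0.
  exact: leq_trans (subset_leq_card bdU) (leq_imset_card _ _).
case: (@arg_minnP _ U tight (fun A => #|A|) tightU) => A /and3P[sAU A0 leA] minA.
have [B' [t' [disjA disjB rootB tB arcB]]] := relink model bdU linked sAU A0.
have inj_t : {in K &, injective t'}.
  move=> y z yK zK eqt; have [[ty _] [tz _]] := (tB y yK, tB z zK).
  by apply: (disjB y z yK zK (t' y)) => //; rewrite eqt.
have bdA : t' @: K = boundary A.
  apply/eqP; rewrite eqEcard card_in_imset // leA andbT.
  by apply/subsetP => _ /imsetP[y yK ->]; case: (tB y yK).
(* The contact vertex of the parent of [x] lies in [boundary A], hence has an in-neighbour in [A].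
   If [x] has no out-arc, any vertex of [A] will do. *)
have [u uA uP] : exists2 u, u \in A & forall y, arc x y -> arc u (t' y).
  have [y xy|noy] := pickP (arc x); last first.
    by have /set0Pn[u uA] := A0; exists u => // y; rewrite noy.
  have [_ /boundaryP[_ [u uA ut]]] := tB y (xK' y xy).
  by exists u => // z /(uniqx _ _ xy) <-.
(* A violating [C] would be a tight set smaller than [A], since it misses [u]. *)
have linkedA (C : {set G}) : C \subset A :\ u -> C != set0 -> #|K| < #|boundary C|.
  rewrite subsetD1 => /andP[sCA uC] C0; rewrite ltnNge; apply/negP => leC.
  have /minA : tight C by rewrite /tight (subset_trans sCA) ?C0.
  by rewrite leqNgt proper_card // properE sCA; apply/subsetPn; exists u.
(* The out-neighbours of [u] outnumber [boundary A], so one of them lies in [A]. *)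
have Au0 : A :\ u != set0.
  have : ~~ ([set w | arc u w] \subset boundary A).
    apply/negP => /subset_leq_card le_out.
    by have := leq_trans le_out leA; rewrite leqNgt outG.
  case/subsetPn => w; rewrite inE => uw wA; apply/set0Pn; exists w.
  rewrite !inE; apply/andP; split; first by apply: contraTneq uw => ->; rewrite arc_irrefl.
  by apply: contraNT wA => wA; apply/boundaryP; split=> //; exists u.
(* One inclusion is clear, and [linkedA] makes the left side large enough for equality. Thus [u] and
   all the old contact vertices are contact vertices for [A :\ u]. *)
have bdAu : boundary (A :\ u) = u |: boundary A.
  apply/eqP; rewrite eqEcard; apply/andP; split.
    apply/subsetP => z /boundaryP[]; rewrite in_setD1 negb_and negbK => zA [a].
    rewrite in_setD1 => /andP[_ aA] az; rewrite in_setU1; have [//|/=] := eqVneq z u.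
    move=> neu; apply/boundaryP; split; last by exists a.
    by move: zA; rewrite (negPf neu).
  apply: leq_trans (linkedA _ (subxx _) Au0).
  by rewrite cardsU1 -add1n leq_add // leq_b1.
exists (A :\ u); split=> //.
  by move=> C sC C0; rewrite cardsU1 xK; apply: linkedA.
have K_x y : y \in K -> (y == x) = false.
  by move=> yK; apply: contraNF xK => /eqP<-.
exists (fun y => if y == x then [set u] else B' y),
  (fun y => if y == x then u else r y), (fun y => if y == x then u else t' y).
split; last first.
  rewrite bdAu; apply/subsetP => z /setU1P[->|].
    by apply/imsetP; exists x; rewrite ?setU11 ?eqxx.
  rewrite -bdA => /imsetP[y yK ->]; apply/imsetP; exists y; rewrite ?K_x //.
  by rewrite in_setU1 yK orbT.
have uB y : y \in K -> u \notin B' y.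
  by move=> yK; rewrite (disjointFl (disjA y yK) uA).
split.
- move=> y /setU1P[->|yK]; rewrite ?eqxx ?K_x //.
    by rewrite disjoints1 !inE eqxx.
  exact: disjointWr (subD1set _ _) (disjA y yK).
- move=> y z /setU1P[->|yK] /setU1P[->|zK] w; rewrite ?eqxx ?K_x //.
  + by rewrite inE => /eqP-> uz; rewrite (negPf (uB z zK)) in uz.
  + by move=> wy /set1P wu; rewrite wu (negPf (uB y yK)) in wy.
  exact: disjB.
- move=> y /setU1P[->|yK]; rewrite ?eqxx ?K_x //; last exact: rootB.
  by split=> [|w]; rewrite inE // => /eqP->.
- move=> y /setU1P[->|yK]; rewrite ?eqxx ?K_x // bdAu.
    by rewrite set11 setU11.
  by have [ty tA] := tB y yK; rewrite in_setU1 tA orbT.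
move=> y z /setU1P[->|yK] /setU1P[->|zK]; rewrite ?eqxx ?K_x //.
- by rewrite arc_irrefl.
- by move=> xz; exists (t' z); [have [] := tB z zK | exact: uP].
- by move=> yx; rewrite (closK y yK x yx) in xK.
exact: arcB.
Qed.

End Construction.

Theorem theorem1p12 (H : digraph) (hH : in_arborescence H) (G : digraph)
    (hG : #|add_apex H| - 1 <= min_outdeg G) :
  exists branch : add_apex H -> {set G},
    butterfly_minor_with (add_apex H) G branch /\ #|branch (apex_source H)| = 1.
Proof.
have [treeH [r0 toR]] := hH.
have outG (v : G) : #|H| <= outdeg v.
  by move: v; apply/min_outdegP; move: hG; rewrite /= card_option subn1.
have stages n : n <= #|H| -> exists (K : {set H}) (U : {set G}),
    [/\ #|K| = n, {in K, forall y z, arc y z -> z \in K} & stage K U].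
  elim: n => [_|n IHn lt_n].
    exists set0, setT; split; [by rewrite cards0 | by move=> y; rewrite inE |].
    have /card_gt0P[g _] := vertex_gt0 G.
    split; [by apply/set0Pn; exists g | by move=> A _ _; rewrite cards0 |].
    exists (fun=> set0), (fun=> g), (fun=> g); split.
      by split=> [x|x y|x|x|x y]; rewrite inE.
    by apply/subsetP => z /boundaryP[]; rewrite inE.
  have [K [U [cardK closK stageK]]] := IHn (ltnW lt_n).
  have [|x] := exists_sink_in treeH toR (D := ~: K).
    by rewrite -card_gt0 cardsCs setCK subn_gt0 cardK.
  rewrite inE => xK outx; have xK' y : arc x y -> y \in K.
    by move=> /outx; rewrite inE negbK.
  have [v | |U' stageU'] := stage_step (x := x) _ closK _ xK' xK stageK.
  - by rewrite cardK; apply: leq_trans lt_n _.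
  - exact: (out_arc_unique treeH toR).
  exists (x |: K), U'; split=> //; first by rewrite cardsU1 xK cardK.
  by move=> y /setU1P[->|yK] z yz; rewrite in_setU1 ?(xK' z yz) ?(closK y yK z yz) orbT.
have [K [U [cardK _ [U0 linked [B [r [t [model bdU]]]]]]]] := stages _ (leqnn _).
have KT x : x \in K.
  suff -> : K = setT by rewrite inE.
  by apply/eqP; rewrite eqEcard subsetT cardsT cardK leqnn.
have /set0Pn[v vU] := U0.
(* The out-boundary of [[set v]] consists of out-neighbours of [v], so every [t' x] receives an arc
   from [v]. *)
have [||B' [t' [disjA disjB rootB tB arcB]]] := relink (A := [set v]) model bdU linked.
- by rewrite sub1set.
- by apply/set0Pn; exists v; rewrite set11.
exists (fun x => if x is Some y then B' y else [set v]); split; last exact: cards1.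
apply: (@apex_butterfly_minor _ _ _ r) => [x y z|x|x|x|x y].
- exact: disjB.
- exact: rootB.
- by rewrite (disjointFl (disjA x (KT x))) ?set11.
- have [tx /boundaryP[_ [w /set1P-> vt]]] := tB x (KT x).
  by exists (t' x).
exact: arcB.
Qed.
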